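(* Let $A$ be an associative, commutative and unital $\mathbb{Q}$-algebra. The set $$G^{\alpha}(A)=\left\{\alpha_f(x)=\big(x^{\mathsf{o}}-x^{\mathsf{v}}\backslash f(x)\big)^{-1}/x^{\mathsf{v}}\ :\ f\in A[[Y]]\right\}$$ is a subgroup of the group $G^{\rho}_Y(A)$ (whose group law is the composition $\circ$ of tree-expanded series).
   Context: A tree means a planar binary rooted tree; its order $|t|$ is the number of its internal (trivalent) vertices. $Y$ is the set of all trees, $\bar Y$ the set of trees of order at least $1$. The root tree (order $0$) is denoted $\mathsf{o}$, the vertex tree (the unique tree of order $1$) is denoted $\mathsf{v}$. For trees $t,s$: $t/s$ (''over'') is obtained by grafting the root of $t$ on the left-most leaf of $s$; $t\backslash s$ (''under'') is obtained by grafting the root of $s$ on the right-most leaf of $t$. Both are associative with unit $\mathsf{o}$, and $(a/b)\backslash c=a/(b\backslash c)$ whenever $b\neq\mathsf{o}$. Every $t\in\bar Y$ can be written uniquely as $t=t^l/\mathsf{v}\backslash t^r$ with $t^l,t^r\in Y$. For $t\in\bar Y$ the $t$-product $\mu_t:\bar Y^{|t|}\to\bar Y$ is obtained by writing $t$ as a monomial in $\mathsf{v}$ for the over and under products and replacing the $i$-th copy of $\mathsf{v}$ (from left to right) by $s_i$; equivalently, recursively, with $n=|t|$ and $k=|t^l|$, $\mu_t(s_1,\dots,s_n)=\mu_{t^l}(s_1,\dots,s_k)/s_{k+1}\backslash\mu_{t^r}(s_{k+2},\dots,s_n)$, with $\mu_{\mathsf{o}}()=\mathsf{o}$. $A[[Y]]$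 (resp. $A[[\bar Y]]$) is the space of formal series $\sum_t f_t\,x^t$, $f_t\in A$, over $t\in Y$ (resp. $t\in\bar Y$); $x^t$ is just a symbol. The products extend bilinearly: $(f/g)(x)=\sum f_tg_s\,x^{t/s}$, $(f\backslash g)(x)=\sum f_tg_s\,x^{t\backslash s}$. The series in $A[[Y]]$ with $f_{\mathsf{o}}=1$ form a group $G^{\mathrm{over}}(A)$ for $/$, with unit $x^{\mathsf{o}}$; the inverse $(\cdot)^{-1}$ in the definition of $\alpha_f$ is taken in this group. $G^{\mathrm{dif}}_Y(A)=\{\varphi\in A[[\bar Y]]:\varphi_{\mathsf{v}}=1\}$ is a group with unit $x^{\mathsf{v}}$ under the composition $(\varphi\circ\psi)(x)=\sum_{t,s_1,\dots,s_{|t|}\in\bar Y}\varphi_t\psi_{s_1}\cdots\psi_{s_{|t|}}\,x^{\mu_t(s_1,\dots,s_{|t|})}$, and $G^{\rho}_Y(A)=\{\rho_g(x)=g(x)/x^{\mathsf{v}} : g\in A[[Y]],\ g_{\mathsf{o}}=1\}$ is a subgroup of it. *)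

(* Defs.v *)
From HB Require Import structures.
From mathcomp Require Import all_boot all_order all_algebra.
From mathcomp Require Import boolp classical_sets.
From mathcomp Require Import zify.

Set Implicit Arguments.
Unset Strict Implicit.
Unset Printing Implicit Defensive.

Import GRing.Theory.
Local Open Scope ring_scope.

(* Planar binary rooted trees: [Leaf] is the root tree o (order 0), and the
   constructor [Node l r] is l / v \ r (see [node_over_under]). *)
Inductive tree : Type := Leaf | Node (l r : tree).

Definition vertex : tree := Node Leaf Leaf.

Fixpoint tree_encode (t : tree) : GenTree.tree unit :=
  if t is Node l r then GenTree.Node 0 [:: tree_encode l; tree_encode r]
  else GenTree.Leaf tt.

Fixpoint tree_decode (g : GenTree.tree unit) : tree :=
  if g is GenTree.Node _ [:: l; r] then Node (tree_decode l) (tree_decode r)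
  else Leaf.

Lemma tree_encodeK : cancel tree_encode tree_decode.
Proof. by elim=> //= l -> r ->. Qed.

HB.instance Definition _ := CanIsCountable tree_encodeK.

Fixpoint order (t : tree) : nat :=
  if t is Node l r then (order l + order r).+1 else 0%N.

(* [over t s] is t / s: the root of t is grafted on the left-most leaf of s. *)
Fixpoint over (t s : tree) : tree :=
  if s is Node l r then Node (over t l) r else t.

(* [under t s] is t \ s: the root of s is grafted on the right-most leaf of t. *)
Fixpoint under (t s : tree) : tree :=
  if t is Node l r then Node l (under r s) else s.

Lemma node_over_under (l r : tree) : Node l r = over l (under vertex r).
Proof. by []. Qed.

(* The t-product mu_t(s_1, ..., s_n).  It is only meant for [size s = order t];
   the default value of [nth] is then never used. *)
Fixpoint mu (t : tree) (s : seq tree) : tree :=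
  if t is Node l r then
    over (mu l (take (order l) s))
         (under (nth Leaf s (order l)) (mu r (drop (order l).+1 s)))
  else Leaf.

Fixpoint trees_height (h : nat) : seq tree :=
  if h is h'.+1 then
    Leaf :: [seq Node l r | l <- trees_height h', r <- trees_height h']
  else [:: Leaf].

Fixpoint words (T : Type) (n : nat) (e : seq T) : seq (seq T) :=
  if n is n'.+1 then [seq x :: w | x <- e, w <- words n' e] else [:: [::]].

(* The finite index sets of the sums giving the coefficient at u of f / g,
   f \ g and phi o psi.  Bounding the height by [order u] loses nothing, see
   [mem_over_fiber], [mem_under_fiber] and [mem_mu_fiber]. *)
Definition over_fiber (u : tree) : seq (tree * tree) :=
  [seq p <- [seq (t, s) | t <- trees_height (order u),
                          s <- trees_height (order u)] | over p.1 p.2 == u].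

Definition under_fiber (u : tree) : seq (tree * tree) :=
  [seq p <- [seq (t, s) | t <- trees_height (order u),
                          s <- trees_height (order u)] | under p.1 p.2 == u].

Definition mu_fiber (u : tree) : seq (tree * seq tree) :=
  [seq p <- [seq (t, s) | t <- trees_height (order u),
                          s <- words (order t) (trees_height (order u))]
   | [&& p.1 != Leaf, all (fun s => s != Leaf) p.2 & mu p.1 p.2 == u]].

Lemma trees_height_uniq (h : nat) : uniq (trees_height h).
Proof.
elim: h => //= h IH; apply/andP; split.
  by apply/allpairsP => -[p []].
by apply: allpairs_uniq => // -[a b] [c d] _ _ [-> ->].
Qed.

Lemma words_uniq (T : eqType) (n : nat) (e : seq T) : uniq e -> uniq (words n e).
Proof.
move=> ue; elim: n => //= n IH.
by apply: allpairs_uniq => // -[a b] [c d] _ _ [-> ->].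
Qed.

Lemma mem_trees_height (h : nat) (t : tree) :
  (order t <= h)%N -> t \in trees_height h.
Proof.
elim: h t => [|h IH] [|l r] //= lth; rewrite in_cons; apply/orP; right.
by apply/allpairsP; exists (l, r); split => //=; apply: IH; lia.
Qed.

Lemma mem_words (T : eqType) (n : nat) (e w : seq T) :
  (w \in words n e) = (size w == n) && all (mem e) w.
Proof.
elim: n w => [|n IH] [|x w] //=.
  by apply/allpairsP => -[p []].
rewrite eqSS; apply/allpairsP/idP => [[[y v]] /= [ye]|].
  by rewrite IH => /andP[/eqP <- av] [-> ->]; rewrite eqxx ye.
by move=> /and3P[sw xe aw]; exists (x, w); rewrite IH sw aw.
Qed.

Lemma order_over (t s : tree) : order (over t s) = (order t + order s)%N.
Proof. by elim: s => //= [|l -> r _]; lia. Qed.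

Lemma order_under (t s : tree) : order (under t s) = (order t + order s)%N.
Proof. by elim: t => //= l _ r ->; lia. Qed.

Lemma order_mu (t : tree) (s : seq tree) :
  size s = order t -> order (mu t s) = sumn (map order s).
Proof.
elim: t s => [|l IHl r IHr] s /=; first by move/size0nil => ->.
move=> ss; rewrite order_over IHl ?size_takel; [|lia..].
rewrite order_under IHr ?size_drop; last lia.
rewrite -[in RHS](cat_take_drop (order l) s) map_cat sumn_cat.
rewrite [in RHS](drop_nth Leaf) /=; lia.
Qed.

Lemma order_gt0 (t : tree) : (0 < order t)%N = (t != Leaf).
Proof. by case: t => [|l r]; [rewrite eqxx | apply/esym/eqP]. Qed.

Lemma over_fiber_uniq (u : tree) : uniq (over_fiber u).
Proof.
apply/filter_uniq/allpairs_uniq; try exact: trees_height_uniq.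
by move=> -[a b] [c d].
Qed.

Lemma under_fiber_uniq (u : tree) : uniq (under_fiber u).
Proof.
apply/filter_uniq/allpairs_uniq; try exact: trees_height_uniq.
by move=> -[a b] [c d].
Qed.

Lemma mu_fiber_uniq (u : tree) : uniq (mu_fiber u).
Proof.
apply/filter_uniq/allpairs_uniq_dep; first exact: trees_height_uniq.
  by move=> t _; apply: words_uniq; apply: trees_height_uniq.
by move=> -[a b] [c d] _ _ /= [-> ->].
Qed.

Lemma mem_over_fiber (u t s : tree) : ((t, s) \in over_fiber u) = (over t s == u).
Proof.
rewrite mem_filter /=; case: eqP => //= <-; apply/allpairsP; exists (t, s).
by split => //; apply: mem_trees_height; rewrite /= order_over; lia.
Qed.

Lemma mem_under_fiber (u t s : tree) :
  ((t, s) \in under_fiber u) = (under t s == u).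
Proof.
rewrite mem_filter /=; case: eqP => //= <-; apply/allpairsP; exists (t, s).
by split => //; apply: mem_trees_height; rewrite /= order_under; lia.
Qed.

Lemma mem_mu_fiber (u t : tree) (s : seq tree) :
  ((t, s) \in mu_fiber u) =
  [&& t != Leaf, size s == order t, all (fun s => s != Leaf) s & mu t s == u].
Proof.
rewrite mem_filter /=; apply/idP/idP => [/andP[/and3P[-> -> ->]]|].
  case/allpairsPdep => t' [s' [_ + [-> ->]]].
  by rewrite mem_words => /andP[-> _].
move=> /and4P[-> /eqP ss as_ /eqP mtu]; rewrite as_ mtu eqxx /=.
have ou : order u = sumn (map order s) by rewrite -mtu order_mu.
have sz : (size s <= order u)%N.
  rewrite ou; elim: s as_ {ss mtu ou} => //= x s IH /andP[].
  by rewrite -order_gt0 => x0 /IH; lia.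
apply/allpairsPdep; exists t, s; split => //.
  by apply: mem_trees_height; rewrite -ss.
rewrite mem_words ss eqxx; apply/allP => x xs /=.
apply: mem_trees_height; rewrite ou.
elim: s xs {ss as_ mtu ou sz} => //= y s IH; rewrite in_cons.
by case/predU1P => [->|/IH]; lia.
Qed.

(* A commutative Q-algebra is a [comPzRingType] A with a ring morphism from
   [rat] to A; unlike [comAlgType rat], this allows the zero algebra.  The
   definitions below only use the ring structure. *)
Section Series.
Variable A : comPzRingType.

(* The formal series A[[Y]]; the coefficient of x^t in f is [f t].  The
   series in A[[\bar Y]] are those with [f Leaf = 0]. *)
Definition series : Type := tree -> A.

Definition mono (t : tree) : series := fun u => (u == t)%:R.

Definition overS (f g : series) : series :=
  fun u => \sum_(p <- over_fiber u) f p.1 * g p.2.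

Definition underS (f g : series) : series :=
  fun u => \sum_(p <- under_fiber u) f p.1 * g p.2.

(* phi o psi; only coefficients at trees of order at least 1 occur. *)
Definition compS (phi psi : series) : series :=
  fun u => \sum_(p <- mu_fiber u) phi p.1 * \prod_(s <- p.2) psi s.

Definition Gover : set series := [set g | g Leaf = 1].

(* h is the inverse of g in the group [Gover] *)
Definition over_inverse (g h : series) : Prop :=
  [/\ Gover g, Gover h, overS g h = mono Leaf & overS h g = mono Leaf].

Definition Grho : set series := [set overS g (mono vertex) | g in Gover].

Definition Galpha : set series :=
  [set phi | exists f h : series,
     over_inverse (mono Leaf \- underS (mono vertex) f) h /\
     phi = overS h (mono vertex)].

End Series.

Arguments mono {A} t.
Arguments compS {A} phi psi.
Arguments Grho A : clear implicits.
Arguments Galpha A : clear implicits.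

Definition is_group (T : Type) (op : T -> T -> T) (e : T) (G : set T) : Prop :=
  [/\ G e,
      forall x y, G x -> G y -> G (op x y),
      forall x y z, G x -> G y -> G z -> op x (op y z) = op (op x y) z,
      forall x, G x -> op e x = x /\ op x e = x &
      forall x, G x -> exists y, [/\ G y, op x y = e & op y x = e]].

Definition is_subgroup (T : Type) (op : T -> T -> T) (e : T) (G H : set T) :
    Prop :=
  [/\ is_group op e G, (H `<=` G)%classic & is_group op e H].

(* Main.v *)
(* Substituting a series psi with psi_o = 0 and psi_v = 1 is an associative
   operation f |-> f^psi, a morphism for both products, and a bijection because
   it is unitriangular for the order of trees.  Writing a_f for the inverse of
   1 - v \ f, the coefficients of a_f are given by a_f(l / v \ r) =
   a_f(l) f(r).  With rho_g = g / v, one has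
   rho_g o rho_h = rho_(g^(rho_h) / h), and if psi = a_f' / v then
     (a_f^psi / a_f') / (1 - v \ f' - v \ f^psi)
       = a_f^psi - a_f^psi / (psi \ f^psi) = (a_f / (1 - v \ f))^psi = 1,
   so that alpha_f o alpha_f' = alpha_(f' + f^psi).  The inverse of alpha_f' is
   therefore alpha_f where f^psi = - f'. *)
Require Import Defs.
From mathcomp Require Import all_boot all_order all_algebra.
From mathcomp Require Import boolp classical_sets.
From mathcomp Require Import zify.
Import Defs.

Set Implicit Arguments.
Unset Strict Implicit.
Unset Printing Implicit Defensive.

Import GRing.Theory.
Local Open Scope ring_scope.

Section TreeSeries.
Variable A : comPzRingType.
Implicit Types (f g h k phi psi chi : series A) (t u : tree).

(** * Monomial series and truncated sums over trees *)

Lemma mono_refl t : mono t t = 1 :> A.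
Proof. by rewrite /mono eqxx. Qed.

Lemma mono_neq t u : u != t -> mono t u = 0 :> A.
Proof. by rewrite /mono => /negPf ->. Qed.

Lemma mono_order_neq t u : order u <> order t -> mono t u = 0 :> A.
Proof. by move=> tu; apply: mono_neq; apply/eqP => ut; rewrite ut in tu. Qed.

Lemma sum_mono (n : nat) (K : tree -> A) t :
  (forall u, (n < order u)%N -> K u = 0) ->
  \sum_(u <- trees_height n) mono t u * K u = K t.
Proof.
move=> K0; case: (boolP (t \in trees_height n)) => tn.
  rewrite (bigD1_seq t) ?trees_height_uniq //= mono_refl mul1r big1 ?addr0 //.
  by move=> u ut; rewrite mono_neq ?mul0r.
rewrite K0 ?big_seq ?big1 //.
  by move=> u un; rewrite mono_neq ?mul0r //; apply: contraNneq tn => <-.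
by rewrite ltnNge; apply: contra tn; apply: mem_trees_height.
Qed.

(** [trees_height n] bounds the height, so it also holds trees of order above [n]. Since [K] kills
    orders above [m], both sums reduce to the trees of order at most [m], which both lists
    contain. *)
Lemma sum_trees_height (m n : nat) (K : tree -> A) :
  (forall u, (m < order u)%N -> K u = 0) -> (m <= n)%N ->
  \sum_(u <- trees_height n) K u = \sum_(u <- trees_height m) K u.
Proof.
move=> K0 mn.
have low (i : nat) : \sum_(u <- trees_height i) K u =
    \sum_(u <- [seq u <- trees_height i | (order u <= m)%N]) K u.
  rewrite big_filter [RHS]big_mkcond; apply: eq_bigr => u _.
  by case: ifPn => //; rewrite -ltnNge => /K0.
rewrite [LHS]low [RHS]low; apply/perm_big/uniq_perm.
- exact/filter_uniq/trees_height_uniq.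
- exact/filter_uniq/trees_height_uniq.
move=> u; rewrite !mem_filter; case: leqP => //= um.
by rewrite !mem_trees_height //; lia.
Qed.

(** * Convolution products of series *)

(* The common shape of the two products: [over] and [under] are handled
   together as convolutions along a binary operation additive in the order. *)
Definition fibers (op : tree -> tree -> tree)
    (fib : tree -> seq (tree * tree)) : Prop :=
  [/\ forall u, uniq (fib u),
      forall u t s, ((t, s) \in fib u) = (op t s == u) &
      forall t s, order (op t s) = (order t + order s)%N].

Lemma over_fibers : fibers over over_fiber.
Proof.
by split; [exact: over_fiber_uniq|exact: mem_over_fiber|exact: order_over].
Qed.

Lemma under_fibers : fibers under under_fiber.
Proof.
by split; [exact: under_fiber_uniq|exact: mem_under_fiber|exact: order_under].
Qed.

Definition conv (fib : tree -> seq (tree * tree)) f g : series A :=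
  fun u => \sum_(p <- fib u) f p.1 * g p.2.

(* For [psi], being in the ambient group G^dif is [leads psi vertex]. *)
Definition leads f t : Prop :=
  forall u, (order u <= order t)%N -> f u = mono t u.

Section Convolution.
Variables (op : tree -> tree -> tree) (fib : tree -> seq (tree * tree)).
Hypothesis opP : fibers op fib.

Lemma eq_conv f g f' g' u :
  (forall t s, op t s = u -> f t * g s = f' t * g' s) ->
  conv fib f g u = conv fib f' g' u.
Proof.
case: opP => _ memf _ E; rewrite /conv big_seq [RHS]big_seq.
by apply: eq_bigr => -[t s]; rewrite memf => /eqP /E.
Qed.

Lemma convBr f g h : conv fib h (f \- g) = conv fib h f \- conv fib h g.
Proof.
by apply: funext => u; rewrite /conv /= -sumrB; apply: eq_bigr => p _; rewrite mulrBr.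
Qed.

Lemma convDr f g h : conv fib h (f \+ g) = conv fib h f \+ conv fib h g.
Proof.
rewrite /conv; apply: funext => u /=; rewrite -big_split /=.
by apply: eq_bigr => p _; rewrite mulrDr.
Qed.

Lemma conv_suml (I : Type) (r : seq I) (c : I -> A) (F : I -> series A) g u :
  conv fib (fun t => \sum_(i <- r) c i * F i t) g u =
  \sum_(i <- r) c i * conv fib (F i) g u.
Proof.
rewrite /conv (eq_bigr _ (fun i _ => mulr_sumr _ _ _ _)) exchange_big /=.
by apply: eq_bigr => p _; rewrite mulr_suml; apply: eq_bigr => i _; rewrite mulrA.
Qed.

Lemma conv_sumr (I : Type) (r : seq I) (c : I -> A) (F : I -> series A) g u :
  conv fib g (fun t => \sum_(i <- r) c i * F i t) u =
  \sum_(i <- r) c i * conv fib g (F i) u.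
Proof.
rewrite /conv (eq_bigr _ (fun i _ => mulr_sumr _ _ _ _)) exchange_big /=.
apply: eq_bigr => p _; rewrite mulr_sumr.
by apply: eq_bigr => i _; rewrite mulrCA.
Qed.

(** Trading the fibre for an indicator makes the index set independent of [u], so that sums over [u]
    can be exchanged with sums over factorisations. *)
Lemma conv_bound (n : nat) f g u : (order u <= n)%N ->
  conv fib f g u = \sum_(a <- trees_height n) \sum_(b <- trees_height n)
                      f a * g b * mono (op a b) u.
Proof.
case: opP => uf memf ord un.
pose P := [seq (a, b) | a <- trees_height n, b <- trees_height n].
have -> : conv fib f g u =
    \sum_(p <- [seq p <- P | op p.1 p.2 == u]) f p.1 * g p.2.
  apply/perm_big/uniq_perm => //.
    apply/filter_uniq/allpairs_uniq; try exact: trees_height_uniq.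
    by move=> -[? ?] [].
  move=> [t s]; rewrite memf mem_filter /=; case: eqP => //= E; apply/esym.
  apply/allpairsP; exists (t, s).
  by split => //; apply: mem_trees_height; move: un; rewrite -E ord /=; lia.
rewrite big_filter big_mkcond big_allpairs /=; apply: eq_bigr => a _.
by apply: eq_bigr => b _; rewrite /mono eq_sym; case: eqP; rewrite ?mulr1 ?mulr0.
Qed.

Lemma sum_conv (n : nat) f g (K : tree -> A) :
  (forall u, (n < order u)%N -> K u = 0) ->
  \sum_(u <- trees_height n) conv fib f g u * K u =
  \sum_(a <- trees_height n) \sum_(b <- trees_height n)
     f a * g b * K (op a b).
Proof.
move=> K0; transitivity (\sum_(u <- trees_height n)
   \sum_(a <- trees_height n) \sum_(b <- trees_height n)
     f a * g b * (mono (op a b) u * K u)).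
  apply: eq_bigr => u _; case: (leqP (order u) n) => un.
    rewrite (conv_bound _ _ un) mulr_suml; apply: eq_bigr => a _.
    by rewrite mulr_suml; apply: eq_bigr => b _; rewrite mulrA.
  rewrite K0 // mulr0 big1 // => a _; rewrite big1 // => b _.
  by rewrite !mulr0.
rewrite exchange_big; apply: eq_bigr => a _ /=.
rewrite exchange_big; apply: eq_bigr => b _ /=.
by rewrite -mulr_sumr sum_mono.
Qed.

Lemma conv_mono t s : conv fib (mono t) (mono s) = mono (op t s).
Proof.
apply: funext => u; rewrite (conv_bound _ _ (leqnn _)).
case: opP => _ _ ord.
rewrite -[RHS](@sum_mono (order u) (fun a => mono (op a s) u)) => [|a ua].
  apply: eq_bigr => a _.
  rewrite -(@sum_mono (order u) (fun b => mono (op a b) u)) => [|b ub].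
    by rewrite mulr_sumr; apply: eq_bigr => b _; rewrite mulrA.
  by rewrite mono_order_neq // ord; lia.
by rewrite mono_order_neq // ord; lia.
Qed.

(** Orders add, so in a factorisation of order at most [order t + order s] either one factor lies
    strictly below its leading order, where the series and its monomial both vanish, or both factors
    have exactly the leading orders. *)
Lemma leads_conv f g t s :
  leads f t -> leads g s -> leads (conv fib f g) (op t s).
Proof.
move=> ft gs u ou; rewrite -conv_mono; apply: eq_conv => a b E.
case: opP ou => _ _ ord; rewrite -E !ord => ou.
case: (ltngtP (order a) (order t)) => at_.
- by rewrite ft ?[mono t a]mono_order_neq ?mul0r //; lia.
- by rewrite gs ?[mono s b]mono_order_neq ?mulr0 //; lia.
- by rewrite ft ?gs //; lia.
Qed.

End Convolution.

(** * Over and under products of series: recursion, associativity, units *)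

Lemma overSBr f g h : overS h (f \- g) = overS h f \- overS h g.
Proof. exact: convBr over_fiber f g h. Qed.

Lemma overS_Leaf f g : overS f g Leaf = f Leaf * g Leaf.
Proof. by rewrite /overS big_seq1. Qed.

Lemma underS_Leaf f g : underS f g Leaf = f Leaf * g Leaf.
Proof. by rewrite /underS big_seq1. Qed.

(** If [over t s] is [Node l r], then [s] is the root tree, or [s] ends in the same vertex with
    right subtree [r] and the factorisation takes place inside [l]. *)
Lemma overS_Node f g l r :
  overS f g (Node l r) =
  f (Node l r) * g Leaf + overS f (fun l' => g (Node l' r)) l.
Proof.
have -> : overS f g (Node l r) = \sum_(p <- (Node l r, Leaf) ::
    [seq (q.1, Node q.2 r) | q <- over_fiber l]) f p.1 * g p.2.
  apply/perm_big/uniq_perm; first exact: over_fiber_uniq.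
    rewrite cons_uniq map_inj_uniq ?over_fiber_uniq ?andbT.
      by apply/mapP => -[[a b]] _ [].
    by move=> [a b] [c d] [-> ->].
  move=> [t s]; rewrite mem_over_fiber in_cons.
  apply/eqP/predU1P => [|[[-> ->] //|/mapP[[a b] + [-> ->]]]]; last first.
    by rewrite mem_over_fiber => /eqP /= ->.
  case: s => [|l' r'] /= => [->|[E ->]]; [by left|right].
  by apply/mapP; exists (t, l'); rewrite ?mem_over_fiber ?E.
by rewrite big_cons big_map.
Qed.

Lemma underS_Node f g l r :
  underS f g (Node l r) =
  f Leaf * g (Node l r) + underS (fun r' => f (Node l r')) g r.
Proof.
have -> : underS f g (Node l r) = \sum_(p <- (Leaf, Node l r) ::
    [seq (Node l q.1, q.2) | q <- under_fiber r]) f p.1 * g p.2.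
  apply/perm_big/uniq_perm; first exact: under_fiber_uniq.
    rewrite cons_uniq map_inj_uniq ?under_fiber_uniq ?andbT.
      by apply/mapP => -[[a b]] _ [].
    by move=> [a b] [c d] [-> ->].
  move=> [t s]; rewrite mem_under_fiber in_cons.
  apply/eqP/predU1P => [|[[-> ->] //|/mapP[[a b] + [-> ->]]]]; last first.
    by rewrite mem_under_fiber => /eqP /= ->.
  case: t => [|l' r'] /= => [->|[-> E]]; [by left|right].
  by apply/mapP; exists (r', s); rewrite ?mem_under_fiber ?E.
by rewrite big_cons big_map.
Qed.

Lemma overS_scaler f g (c : A) u :
  overS f (fun t => g t * c) u = overS f g u * c.
Proof.
by rewrite /overS mulr_suml; apply: eq_bigr => p _; rewrite mulrA.
Qed.

Lemma underS_scalel f g (c : A) u :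
  underS (fun t => c * f t) g u = c * underS f g u.
Proof.
by rewrite /underS mulr_sumr; apply: eq_bigr => p _; rewrite mulrA.
Qed.

Lemma overSA f g h : overS (overS f g) h = overS f (overS g h).
Proof.
apply: funext => u; elim: u h => [|l IH r _] h.
  by rewrite !overS_Leaf mulrA.
rewrite !overS_Node !overS_Leaf IH mulrDl mulrA -addrA; congr (_ + _).
have -> : (fun l' => overS g h (Node l' r)) =
    (fun t => g (Node t r) * h Leaf) \+ overS g (fun t => h (Node t r)).
  by apply: funext => l'; rewrite overS_Node.
by rewrite [overS f (_ \+ _)](convDr over_fiber) /= -overS_scaler.
Qed.

Lemma underSA f g h : underS (underS f g) h = underS f (underS g h).
Proof.
apply: funext => u; elim: u f => [|l _ r IH] f.
  by rewrite !underS_Leaf mulrA.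
rewrite !underS_Node !underS_Leaf -IH mulrDr mulrA -addrA; congr (_ + _).
rewrite -underS_scalel.
rewrite /underS -big_split /=; apply: eq_bigr => p _.
by rewrite -/(underS _ _ _) underS_Node mulrDl.
Qed.

(** The condition on [g] is the series form of requiring a middle tree of positive order. It removes
    the boundary terms of both recursions; what remains cuts [l] and [r] independently, and the two
    sums are exchanged. *)
Lemma over_under_assoc f g h : g Leaf = 0 ->
  underS (overS f g) h = overS f (underS g h).
Proof.
move=> g0; apply: funext => -[|l r].
  by rewrite underS_Leaf !overS_Leaf underS_Leaf mulrA.
rewrite underS_Node overS_Node overS_Leaf underS_Leaf g0 !(mulr0, mul0r) !add0r.
rewrite /underS (eq_bigr (fun p => \sum_(q <- over_fiber l)
    f q.1 * g (Node q.2 p.1) * h p.2)) => [|p _]; last first.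
  by rewrite overS_Node g0 mulr0 add0r mulr_suml.
rewrite exchange_big; apply: eq_bigr => q _ /=.
rewrite -/(underS _ _ _) underS_Node g0 mul0r add0r mulr_sumr.
by apply: eq_bigr => p _; rewrite mulrA.
Qed.

Lemma mono_Leaf l r : mono Leaf (Node l r) = 0 :> A.
Proof. exact: mono_order_neq. Qed.

Lemma overS1 f : overS f (mono Leaf) = f.
Proof.
apply: funext => -[|l r]; first by rewrite overS_Leaf mono_refl mulr1.
rewrite overS_Node mono_refl mulr1 /overS big1 ?addr0 // => p _.
by rewrite mono_Leaf mulr0.
Qed.

Lemma overS1l f : overS (mono Leaf) f = f.
Proof.
apply: funext => u; elim: u f => [|l IH r _] f.
  by rewrite overS_Leaf mono_refl mul1r.
by rewrite overS_Node IH mono_Leaf mul0r add0r.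
Qed.

Lemma underS1l f : underS (mono Leaf) f = f.
Proof.
apply: funext => -[|l r]; first by rewrite underS_Leaf mono_refl mul1r.
rewrite underS_Node mono_refl mul1r /underS big1 ?addr0 // => p _.
by rewrite mono_Leaf mul0r.
Qed.

Lemma underS1 f : underS f (mono Leaf) = f.
Proof.
apply: funext => u; elim: u f => [|l _ r IH] f.
  by rewrite underS_Leaf mono_refl mulr1.
by rewrite underS_Node IH mono_Leaf mulr0 add0r.
Qed.

(** * Substitution of a series *)

(** The multilinear extension of the [t]-product with every argument equal to [psi]. *)
Fixpoint tree_eval psi t : series A :=
  if t is Node l r then overS (tree_eval psi l) (underS psi (tree_eval psi r))
  else mono Leaf.

(** When [leads psi vertex] holds, [tree_eval psi t] starts at order [order t], so the cut-off at
    [order u] loses nothing. The term at [Leaf] is kept, so that the common unit of both products is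
    preserved. *)
Definition subst f psi : series A :=
  fun u => \sum_(t <- trees_height (order u)) f t * tree_eval psi t u.

Lemma leads_Leaf psi : leads psi vertex -> psi Leaf = 0.
Proof. by move/(_ Leaf isT) => ->; exact: mono_order_neq. Qed.

Lemma leads_tree_eval psi t : leads psi vertex -> leads (tree_eval psi t) t.
Proof.
move=> psi1; elim: t => [|l IHl r IHr] //=.
rewrite node_over_under; apply: (leads_conv over_fibers) => //.
exact: (leads_conv under_fibers).
Qed.

Lemma tree_eval_gt psi t u : leads psi vertex ->
  (order u < order t)%N -> tree_eval psi t u = 0.
Proof.
move=> psi1 ut; rewrite leads_tree_eval ?mono_order_neq //; lia.
Qed.

Lemma tree_eval_over psi t s :
  tree_eval psi (over t s) = overS (tree_eval psi t) (tree_eval psi s).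
Proof.
elim: s => [|l IH r _] /=; first by rewrite overS1.
by rewrite IH overSA.
Qed.

Lemma tree_eval_under psi t s : psi Leaf = 0 ->
  tree_eval psi (under t s) = underS (tree_eval psi t) (tree_eval psi s).
Proof.
move=> psi0; elim: t => [|l _ r IH] /=; first by rewrite underS1l.
by rewrite IH -underSA over_under_assoc // underS_Leaf psi0 mul0r.
Qed.

Lemma tree_eval_vertex t : tree_eval (mono vertex) t = mono t.
Proof.
elim: t => [|l IHl r IHr] //=; rewrite IHl IHr.
by rewrite [underS _ _](conv_mono under_fibers) [overS _ _](conv_mono over_fibers).
Qed.

Lemma subst_bound (n : nat) f psi u : leads psi vertex -> (order u <= n)%N ->
  subst f psi u = \sum_(t <- trees_height n) f t * tree_eval psi t u.
Proof.
move=> psi1 un; apply/esym/sum_trees_height => // t ut.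
by rewrite tree_eval_gt ?mulr0.
Qed.

Lemma subst_conv op fib f g psi : fibers op fib -> leads psi vertex ->
  (forall t s, tree_eval psi (op t s) =
               conv fib (tree_eval psi t) (tree_eval psi s)) ->
  subst (conv fib f g) psi = conv fib (subst f psi) (subst g psi).
Proof.
move=> opP psi1 Eop; apply: funext => u.
rewrite /subst (sum_conv opP) => [|t ut]; last by rewrite tree_eval_gt.
(* The range in [subst] varies with the tree; a range fixed by [u] lets the sums be pulled out of
   the convolution. It suffices, because factors of [u] have order at most [order u]. *)
pose trunc k : series A := fun t =>
  \sum_(a <- trees_height (order u)) k a * tree_eval psi a t.
rewrite (@eq_conv op _ opP _ _ (trunc f) (trunc g)) => [|t s E].
  rewrite conv_suml; apply: eq_bigr => a _.
  rewrite conv_sumr mulr_sumr; apply: eq_bigr => b _.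
  by rewrite Eop mulrA.
have [_ _ ord] := opP.
by rewrite -/(subst f psi t) -/(subst g psi s) !(@subst_bound (order u)) //
  -E ord; lia.
Qed.

Lemma subst_over f g psi : leads psi vertex ->
  subst (overS f g) psi = overS (subst f psi) (subst g psi).
Proof.
move=> psi1; apply: (subst_conv f g over_fibers psi1).
exact: tree_eval_over.
Qed.

Lemma subst_under f g psi : leads psi vertex ->
  subst (underS f g) psi = underS (subst f psi) (subst g psi).
Proof.
move=> psi1; apply: (subst_conv f g under_fibers psi1) => t s.
exact/tree_eval_under/leads_Leaf.
Qed.

Lemma substB f g psi : subst (f \- g) psi = subst f psi \- subst g psi.
Proof.
apply: funext => u; rewrite /subst /= -sumrB.
by apply: eq_bigr => t _; rewrite mulrBl.
Qed.

Lemma subst_mono t psi : leads psi vertex ->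
  subst (mono t) psi = tree_eval psi t.
Proof.
move=> psi1; apply: funext => u.
by rewrite /subst sum_mono // => s us; rewrite tree_eval_gt.
Qed.

Lemma subst_vertex f : subst f (mono vertex) = f.
Proof.
apply: funext => u; rewrite /subst.
rewrite (bigD1_seq u) ?trees_height_uniq ?mem_trees_height //=.
rewrite tree_eval_vertex mono_refl mulr1 big1 ?addr0 // => t tu.
by rewrite tree_eval_vertex mono_neq ?mulr0 // eq_sym.
Qed.

Lemma vertex_subst psi : leads psi vertex -> subst (mono vertex) psi = psi.
Proof. by move/subst_mono => -> /=; rewrite overS1l underS1. Qed.

Lemma subst_tree_eval t psi chi : leads psi vertex -> leads chi vertex ->
  subst (tree_eval psi t) chi = tree_eval (subst psi chi) t.
Proof.
move=> psi1 chi1; elim: t => [|l IHl r IHr] /=; first by rewrite subst_mono.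
by rewrite subst_over // subst_under // IHl IHr.
Qed.

(** Being a morphism for both products, substitution of [chi] carries [tree_eval psi s] to
    [tree_eval (subst psi chi) s]; linearity and an exchange of sums do the rest. *)
Lemma substA f psi chi : leads psi vertex -> leads chi vertex ->
  subst (subst f psi) chi = subst f (subst psi chi).
Proof.
move=> psi1 chi1; apply: funext => u; rewrite {1}/subst.
transitivity (\sum_(t <- trees_height (order u))
   (\sum_(s <- trees_height (order u)) f s * tree_eval psi s t)
     * tree_eval chi t u).
  apply: eq_bigr => t _; case: (leqP (order t) (order u)) => tu.
    by rewrite (subst_bound _ psi1 tu).
  by rewrite tree_eval_gt // !mulr0.
under eq_bigr => t _ do rewrite mulr_suml.
rewrite exchange_big; apply: eq_bigr => s _ /=.
rewrite -subst_tree_eval // /subst mulr_sumr.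
by apply: eq_bigr => t _; rewrite mulrA.
Qed.

(** * Composition of series as substitution *)

Lemma sum_words (p q : nat) (e : seq tree) (F : seq tree -> A) :
  \sum_(w <- words (p + q) e) F w =
  \sum_(w1 <- words p e) \sum_(w2 <- words q e) F (w1 ++ w2).
Proof.
elim: p F => [|p IH] F; first by rewrite big_seq1.
rewrite addSn /= !big_allpairs_dep; apply: eq_bigr => x _.
by rewrite (IH (fun w => F (x :: w))).
Qed.

(** A general test function [K] is used instead of one coefficient, so that the induction hypotheses
    apply to [K] precomposed with grafting. *)
Lemma sum_mu (n : nat) psi t (K : tree -> A) :
  (forall u, (n < order u)%N -> K u = 0) ->
  \sum_(w <- words (order t) (trees_height n))
     (\prod_(s <- w) psi s) * K (mu t w) =
  \sum_(a <- trees_height n) tree_eval psi t a * K a.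
Proof.
elim: t K => [|l IHl r IHr] K K0; first by rewrite big_seq1 big_nil mul1r sum_mono.
(* A word is cut into the block for [l] and the rest, whose first letter goes to the middle vertex
   and whose tail is the block for [r]. *)
rewrite -[order (Node l r)]/((order l + order r).+1) -addnS sum_words.
transitivity (\sum_(w1 <- words (order l) (trees_height n))
  (\prod_(s <- w1) psi s) * \sum_(b <- trees_height n)
    underS psi (tree_eval psi r) b * K (over (mu l w1) b)).
  rewrite big_seq [RHS]big_seq; apply: eq_bigr => w1.
  rewrite mem_words => /andP[/eqP sw1 _].
  rewrite (sum_conv under_fibers) => [|b nb]; last first.
    by rewrite K0 // order_over; lia.
  rewrite /= big_allpairs_dep mulr_sumr; apply: eq_bigr => x _.
  transitivity ((\prod_(s <- w1) psi s) * (psi x *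
    \sum_(w2 <- words (order r) (trees_height n))
      (\prod_(s <- w2) psi s) * K (over (mu l w1) (under x (mu r w2))))).
    rewrite !mulr_sumr; apply: eq_bigr => w2 _.
    rewrite big_cat big_cons take_size_cat // nth_cat sw1 ltnn subnn /=.
    by rewrite -cat_rcons drop_size_cat ?size_rcons ?sw1 // !mulrA.
  rewrite (IHr (fun d => K (over (mu l w1) (under x d)))) => [|d nd].
    congr (_ * _); rewrite mulr_sumr.
    by apply: eq_bigr => d _; rewrite mulrA.
  by rewrite K0 // order_over order_under; lia.
rewrite (IHl (fun a => \sum_(b <- trees_height n)
    underS psi (tree_eval psi r) b * K (over a b))) => [|a na]; last first.
  by rewrite big1 // => b _; rewrite K0 ?mulr0 // order_over; lia.
rewrite /= (sum_conv over_fibers) //; apply: eq_bigr => a _.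
by rewrite mulr_sumr; apply: eq_bigr => b _; rewrite mulrA.
Qed.

(** The trees and words with a root tree that [mu_fiber] excludes carry a factor [phi Leaf] or
    [psi Leaf], so they can be added back; then [sum_mu] applies with [mono u] as test function. *)
Lemma compS_subst phi psi : phi Leaf = 0 -> psi Leaf = 0 ->
  compS phi psi = subst phi psi.
Proof.
move=> phi0 psi0; apply: funext => u.
rewrite /compS /subst big_filter big_mkcond big_allpairs_dep /=.
apply: eq_bigr => t _; case: (eqVneq t Leaf) => [->|t0] /=.
  by rewrite phi0 mul0r big1.
transitivity (phi t * \sum_(w <- words (order t) (trees_height (order u)))
    (\prod_(s <- w) psi s) * mono u (mu t w)).
  rewrite mulr_sumr; apply: eq_bigr => w _.
  case: (boolP (all _ w)) => [_|/allPn[s sw]] /=.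
    by rewrite /mono; case: eqP => _; rewrite ?mulr1 ?mulr0.
  rewrite negbK => /eqP s0.
  by rewrite (big_rem s) //= s0 psi0 !mul0r mulr0.
rewrite sum_mu => [|a ua]; last by rewrite mono_order_neq //; lia.
congr (_ * _); rewrite (bigD1_seq u) ?trees_height_uniq ?mem_trees_height //=.
rewrite mono_refl mulr1 big1 ?addr0 // => a au.
by rewrite mono_neq ?mulr0.
Qed.

(** * Solving triangular equations order by order *)

(** Each application of [Phi] settles one more order, so the iterates stabilise coefficientwise. *)
Lemma contraction_fixpoint (Phi : series A -> series A) :
  (forall f f' u, (forall t, (order t < order u)%N -> f t = f' t) ->
     Phi f u = Phi f' u) ->
  exists f, Phi f = f.
Proof.
move=> contr; pose F n : series A := iter n Phi (mono Leaf).
have F_stable m n u : (order u < m)%N -> (order u < n)%N -> F m u = F n u.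
  elim: m n u => [|m IH] [|n] u //= um un.
  by apply: contr => t tu; apply: IH; lia.
(* Order 0 is settled only by the first application of [Phi], hence the successor. *)
exists (fun u => F (order u).+1 u); apply: funext => u.
by apply: contr => t tu; apply: F_stable.
Qed.

Lemma subst_surj psi k : leads psi vertex -> exists f, subst f psi = k.
Proof.
move=> psi1.
have [|f Ef] := @contraction_fixpoint
  (* [subst f (mono vertex)] is [f] itself, written so that the difference is taken term by term.
     Terms with [order u <= order t] cancel, because [tree_eval psi t] agrees with [mono t] up to
     order [order t]. *)
  (fun f u => k u - (subst f psi u - subst f (mono vertex) u)).
  move=> f f' u ff'; congr (_ - _); rewrite /subst -!sumrB.
  apply: eq_bigr => t _; rewrite -!mulrBr tree_eval_vertex.
  case: (ltnP (order t) (order u)) => [/ff' -> //|ut].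
  by rewrite leads_tree_eval // subrr !mulr0.
exists f; apply: funext => u; move/(congr1 (fun g : series A => g u)): Ef.
by rewrite subst_vertex => /eqP; rewrite opprB addrA subr_eq addrC => /eqP /addrI.
Qed.

(** With constant term 1 in [h], the difference of [overS g h] and [g] involves only coefficients of
    [g] of smaller order. *)
Lemma overS_surj h k : h Leaf = 1 -> exists g, overS g h = k.
Proof.
move=> h1.
have [|g Eg] := @contraction_fixpoint (fun g u => k u - (overS g h u - g u)).
  move=> g g' [|l r] gg'; first by rewrite !overS_Leaf h1 !mulr1 !subrr.
  congr (_ - _); rewrite !overS_Node h1 !mulr1 ![g _ + _]addrC ![g' _ + _]addrC.
  rewrite !addrK; apply: (eq_conv over_fibers) => t s E.
  by rewrite gg' //= -E order_over; lia.
exists g; apply: funext => u; move/(congr1 (fun f : series A => f u)): Eg.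
by move=> /eqP; rewrite opprB addrA subr_eq addrC => /eqP /addrI.
Qed.

(** * The series [rho g] and [rho (alpha f)] *)

Definition rho g : series A := overS g (mono vertex).

Lemma leads_rho g : g Leaf = 1 -> leads (rho g) vertex.
Proof.
move=> g1; apply: (@leads_conv _ _ over_fibers g (mono vertex) Leaf vertex) => //.
by case=> //; rewrite mono_refl.
Qed.

Lemma GrhoP phi : Grho A phi <-> exists2 g, g Leaf = 1 & phi = rho g.
Proof. by split=> [[g g1 <-]|[g g1 ->]]; exists g. Qed.

Lemma subst_Leaf f psi : subst f psi Leaf = f Leaf.
Proof. by rewrite /subst big_seq1 /= mono_refl mulr1. Qed.

Lemma rho_1 : rho (mono Leaf) = mono vertex.
Proof. exact: overS1l. Qed.

Lemma subst_rho g h : h Leaf = 1 ->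
  subst (rho g) (rho h) = rho (overS (subst g (rho h)) h).
Proof.
move=> h1; have hv := leads_rho h1.
by rewrite /rho subst_over // vertex_subst // overSA.
Qed.

(* The coefficients of the inverse of [1 - v \ f]. *)
Fixpoint alpha f t : A := if t is Node l r then alpha f l * f r else 1.

Definition alpha_den f : series A := mono Leaf \- underS (mono vertex) f.

Lemma overS_vunder g f l r :
  overS g (underS (mono vertex) f) (Node l r) = g l * f r.
Proof.
have vl l' r' : underS (mono vertex) f (Node l' r') = mono Leaf l' * f r'.
  rewrite underS_Node mono_order_neq // mul0r add0r -{2}(underS1l f).
  (* The coefficient of [mono vertex] at [Node l' s] is the product of those of [mono Leaf] at [l']
     and at [s]. *)
  rewrite -underS_scalel; congr underS; apply: funext => s.
  case: l' s => [|a b] [|c d]; rewrite ?mono_refl ?mul1r ?mulr1 //.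
  - by rewrite !mono_neq ?mulr0 //; apply/eqP.
  - by rewrite !mono_neq ?mul0r //; apply/eqP.
  - by rewrite !mono_neq ?mul0r //; apply/eqP.
rewrite overS_Node underS_Leaf mono_order_neq // mul0r mulr0 add0r.
under [X in overS _ X]funext => l' do rewrite vl.
by rewrite overS_scaler overS1.
Qed.

Lemma alphaK f : overS (alpha f) (alpha_den f) = mono Leaf.
Proof.
rewrite overSBr overS1; apply: funext.
case=> [|l r] /=; last by rewrite overS_vunder subrr mono_Leaf.
by rewrite overS_Leaf underS_Leaf mono_order_neq // mul0r mulr0 subr0 mono_refl.
Qed.

(** [alpha f] has constant term 1, hence a left inverse, which associativity identifies with its
    right inverse [alpha_den f]. *)
Lemma alphaVK f : overS (alpha_den f) (alpha f) = mono Leaf.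
Proof.
have [k kK] := @overS_surj (alpha f) (mono Leaf) erefl.
suff <- : k = alpha_den f by [].
by rewrite -(overS1 k) -(alphaK f) -overSA kK overS1l.
Qed.

Lemma alpha_unique f g : overS g (alpha_den f) = mono Leaf <-> g = alpha f.
Proof.
split=> [E|->]; last exact: alphaK.
by rewrite -(overS1 g) -(alphaVK f) -overSA E overS1l.
Qed.

Lemma GalphaP phi : Galpha A phi <-> exists f, phi = rho (alpha f).
Proof.
split=> [[f [h [[_ _ _ /alpha_unique ->] ->]]]|[f ->]]; first by exists f.
exists f, (alpha f); split => //; split => //; last exact: alphaK.
  by rewrite /Gover /= mono_refl underS_Leaf mono_order_neq // mul0r subr0.
exact: alphaVK.
Qed.

Lemma subst_rho_alpha f f' :
  subst (rho (alpha f)) (rho (alpha f')) =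
  rho (alpha (f' \+ subst f (rho (alpha f')))).
Proof.
set psi := rho (alpha f'); have psi1 : leads psi vertex by exact: leads_rho.
rewrite subst_rho // -/psi; congr rho; apply/alpha_unique.
have -> : alpha_den (f' \+ subst f psi) =
    alpha_den f' \- underS (mono vertex) (subst f psi).
  rewrite /alpha_den [underS _ (_ \+ _)](convDr under_fiber).
  by apply: funext => u /=; rewrite opprD addrA.
rewrite overSBr !overSA alphaK overS1.
(* Mixed associativity applies with the vertex in the middle and makes [psi] appear; every remaining
   factor is then an image under substitution of [psi]. *)
rewrite -over_under_assoc ?mono_order_neq // -/(rho _) -/psi.
have <- : subst (underS (mono vertex) f) psi = underS psi (subst f psi).
  by rewrite subst_under // vertex_subst.
rewrite -subst_over // -substB.
rewrite -{1}(overS1 (alpha f)) -overSBr.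
by rewrite -/(alpha_den f) alphaK subst_mono.
Qed.

Lemma alpha0 : alpha (fun=> 0) = mono Leaf.
Proof.
by apply: funext => -[|l r]; rewrite ?mono_refl // mono_Leaf /= mulr0.
Qed.

End TreeSeries.

(** * The group axioms *)

(** If [y] is a left inverse of [x] and [z] one of [y], then [z = z (y x) = (z y) x = x], so [y] is
    two-sided. *)
Lemma is_group_left_inverse (T : Type) (op : T -> T -> T) (e : T) (G : set T) :
  G e -> (forall x y, G x -> G y -> G (op x y)) ->
  (forall x y z, G x -> G y -> G z -> op x (op y z) = op (op x y) z) ->
  (forall x, G x -> op e x = x /\ op x e = x) ->
  (forall x, G x -> exists2 y, G y & op y x = e) ->
  is_group op e G.
Proof.
move=> Ge GM opA op1 opV; split => // x Gx.
have [y Gy yx] := opV x Gx; have [z Gz zy] := opV y Gy.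
exists y; split => //; suff <- : z = x by [].
by rewrite -[LHS](op1 z Gz).2 -yx opA // zy (op1 x Gx).1.
Qed.

Theorem theorem4p8 (A : comPzRingType) (iota : {rmorphism rat -> A}) :
  is_subgroup (@compS A) (mono vertex) (Grho A) (Galpha A).
Proof.
have compE phi psi : Grho A phi -> Grho A psi -> compS phi psi = subst phi psi.
  move=> /GrhoP[g g1 ->] /GrhoP[h h1 ->].
  by rewrite compS_subst //; apply/leads_Leaf/leads_rho.
have Gleads phi : Grho A phi -> leads phi vertex.
  by move=> /GrhoP[g g1 ->]; apply: leads_rho.
have alpha_rho : (Galpha A `<=` Grho A)%classic.
  by move=> phi /GalphaP[f ->]; apply/GrhoP; exists (alpha f).
have Grho1 : Grho A (mono vertex).
  by apply/GrhoP; exists (mono Leaf); rewrite ?mono_refl ?rho_1.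
have GrhoM phi psi : Grho A phi -> Grho A psi -> Grho A (compS phi psi).
  move=> Gphi Gpsi; rewrite compE //.
  case/GrhoP: Gphi => g g1 ->; case/GrhoP: Gpsi => h h1 ->.
  rewrite subst_rho //; apply/GrhoP; eexists; last by [].
  by rewrite overS_Leaf subst_Leaf g1 h1 mulr1.
have compA phi psi chi : Grho A phi -> Grho A psi -> Grho A chi ->
    compS phi (compS psi chi) = compS (compS phi psi) chi.
  move=> Gphi Gpsi Gchi.
  rewrite (compE _ _ Gphi (GrhoM _ _ Gpsi Gchi)) (compE _ _ Gpsi Gchi).
  rewrite (compE _ _ (GrhoM _ _ Gphi Gpsi) Gchi) (compE _ _ Gphi Gpsi).
  by rewrite substA //; apply: Gleads.
have comp1 phi : Grho A phi ->
    compS (mono vertex) phi = phi /\ compS phi (mono vertex) = phi.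
  move=> Gphi; rewrite !compE // subst_vertex vertex_subst //.
  exact: Gleads.
split => //; apply: is_group_left_inverse => //.
- move=> psi Gpsi; case/GrhoP: (Gpsi) => h h1 Epsi.
  (* A left inverse [rho g] of [psi = rho h] needs [overS (subst g psi) h] to be the unit: first
     invert [h], then undo the substitution. *)
  have [k kh] := overS_surj (mono Leaf) h1.
  have [g gk] := subst_surj k (Gleads _ Gpsi).
  (* Substitution keeps the constant term, and that of [k] is 1 because [k Leaf * h Leaf = 1]. *)
  have g1 : g Leaf = 1.
    rewrite -(subst_Leaf g psi) gk -[k Leaf]mulr1 -{1}h1 -overS_Leaf kh.
    exact: mono_refl.
  have Gg : Grho A (rho g) by apply/GrhoP; exists g.
  exists (rho g) => //.
  by rewrite compE // Epsi subst_rho // -Epsi gk kh rho_1.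
- by apply/GalphaP; exists (fun=> 0); rewrite alpha0 rho_1.
- move=> phi psi Gphi Gpsi; rewrite compE; try exact: alpha_rho.
  case/GalphaP: Gphi => f ->; case/GalphaP: Gpsi => f' ->.
  by rewrite subst_rho_alpha; apply/GalphaP; eexists.
- by move=> phi psi chi Gphi Gpsi Gchi; apply: compA; apply: alpha_rho.
- by move=> phi Gphi; apply/comp1/alpha_rho.
move=> psi Gpsi; have Gpsi' := alpha_rho _ Gpsi.
case/GalphaP: (Gpsi) => f' Epsi.
have [f Ef] := subst_surj (fun t => - f' t) (Gleads _ Gpsi').
have Gf : Galpha A (rho (alpha f)) by apply/GalphaP; exists f.
exists (rho (alpha f)) => //; rewrite compE //; last exact: alpha_rho.
rewrite Epsi subst_rho_alpha -Epsi Ef.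
have -> : f' \+ (fun t => - f' t) = fun=> 0.
  by apply: funext => t /=; rewrite subrr.
by rewrite alpha0 rho_1.
Qed.
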